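(* Suppose $S:\mathbb{R}^n\rightrightarrows\mathbb{R}^m$ is locally closed and $\mathrm{gph}(S)$ is Clarke regular at $(\bar x,\bar y)\in\mathrm{gph}(S)$. Let $H:\mathbb{R}^n\rightrightarrows\mathbb{R}^m$ be a prefan. Then $S$ is pseudo strictly $H$-differentiable at $(\bar x,\bar y)$ if and only if $$DS(\bar x\mid\bar y)(p)\cap[-H(-p)]\neq\emptyset\quad\text{for all }p\in\mathbb{R}^n\setminus\{0\}.$$
   Context: A set-valued map $S:\mathbb{R}^n\rightrightarrows\mathbb{R}^m$ assigns to each $x$ a subset $S(x)\subset\mathbb{R}^m$ (possibly empty); its graph is $\mathrm{gph}(S)=\{(x,y)\mid y\in S(x)\}$. $S$ is locally closed at $(\bar x,\bar y)\in\mathrm{gph}(S)$ if $\mathrm{gph}(S)\cap\mathbb{B}_\epsilon((\bar x,\bar y))$ is closed for some $\epsilon>0$, where $\mathbb{B}_\epsilon(z)$ is the closed ball of radius $\epsilon$ centered at $z$; $\mathbb{B}$ is the closed unit ball. $H:\mathbb{R}^n\rightrightarrows\mathbb{R}^m$ is positively homogeneous if $0\in H(0)$ and $H(kw)=kH(w)$ for all $k>0$, $w\in\mathbb{R}^n$. For a real $\delta>0$, $(H+\delta)(w):=H(w)+\delta\|w\|\mathbb{B}$. $H$ is a prefan if it is positively homogeneous, $H(p)$ is nonempty, convex and compact for all $p$, and $\|H\|^{+}:=\sup_{\|w\|\le1}\sup_{z\in H(w)}\|z\|$ is finite. $S$ is pseudo strictly $H$-differentiable at $(\bar x,\bar y)\in\mathrm{gph}(S)$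 if for any $\delta>0$ there are neighborhoods $U_\delta$ of $\bar x$ and $V_\delta$ of $\bar y$ such that $S(x)\cap V_\delta\subset S(x')+(H+\delta)(x-x')$ for all $x,x'\in U_\delta$. For a set $C$ and $\bar z\in C$, the tangent (contingent) cone $T_C(\bar z)$ is the set of $w$ such that $(z_i-\bar z)/\tau_i\to w$ for some $z_i\to\bar z$, $z_i\in C$, $\tau_i\searrow0$. The graphical derivative $DS(\bar x\mid\bar y)$ is defined by $\mathrm{gph}(DS(\bar x\mid\bar y))=T_{\mathrm{gph}(S)}(\bar x,\bar y)$. A (locally) closed set $C\subset\mathbb{R}^N$ is Clarke regular at $\bar z\in C$ if the map $T_C:C\rightrightarrows\mathbb{R}^N$ is inner semicontinuous at $\bar z$ with respect to $C$: for every $\rho>0$ and $\epsilon>0$ there is a neighborhood $V$ of $\bar z$ such that $T_C(\bar z)\cap\rho\mathbb{B}\subset T_C(z)+\epsilon\mathbb{B}$ for all $z\in C\cap V$. *)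

(* Defs.v *)
From HB Require Import structures.
From mathcomp Require Import all_boot all_order all_algebra.
From mathcomp Require Import all_classical all_reals all_analysis.

Set Implicit Arguments.
Unset Strict Implicit.
Unset Printing Implicit Defensive.

Import Order.TTheory GRing.Theory Num.Theory.
Import numFieldNormedType.Exports.

Local Open Scope classical_set_scope.
Local Open Scope ring_scope.

(* The library norm on 'rV[R]_N is the sup norm, hence this definition; the
   topology of 'rV[R]_N (nbhs, closed, compact, -->) is the Euclidean one. *)
Definition enorm (R : realType) (N : nat) (x : 'rV[R]_N) : R :=
  Num.sqrt (\sum_(i < N) x 0 i ^+ 2).

Definition cball (R : realType) (N : nat) (c : 'rV[R]_N) (r : R) :
  set 'rV[R]_N := [set z | enorm (z - c) <= r].

Definition msum (R : realType) (N : nat) (A B : set 'rV[R]_N) :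
  set 'rV[R]_N := [set a + b | a in A & b in B].

Definition setmap (R : realType) (n m : nat) : Type :=
  'rV[R]_n -> set 'rV[R]_m.

(* The pair (x, y) in R^n x R^m is encoded as the concatenation row_mx x y in
   R^(n + m), so that enorm is the Euclidean norm of the product. *)
Definition gph (R : realType) (n m : nat) (S : setmap R n m) :
  set 'rV[R]_(n + m) := [set z | S (lsubmx z) (rsubmx z)].

Definition locally_closed_at (R : realType) (n m : nat) (S : setmap R n m)
    (x : 'rV[R]_n) (y : 'rV[R]_m) : Prop :=
  exists2 e : R, 0 < e & closed (gph S `&` cball (row_mx x y) e).

Definition positively_homogeneous (R : realType) (n m : nat)
    (H : setmap R n m) : Prop :=
  H 0 0 /\
  forall (k : R) (w : 'rV[R]_n), 0 < k -> H (k *: w) = [set k *: z | z in H w].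

Definition map_plus (R : realType) (n m : nat) (H : setmap R n m) (d : R) :
    setmap R n m :=
  fun w => msum (H w) [set (d * enorm w) *: b | b in cball 0 1].

Definition outer_norm (R : realType) (n m : nat) (H : setmap R n m) : \bar R :=
  ereal_sup [set ereal_sup [set (enorm z)%:E | z in H w]
            | w in [set w : 'rV[R]_n | enorm w <= 1]].

Definition prefan (R : realType) (n m : nat) (H : setmap R n m) : Prop :=
  [/\ positively_homogeneous H,
      forall p, [/\ H p !=set0, convex_set (H p) & compact (H p)]
    & outer_norm H \is a fin_num].

Definition pseudo_strictly_differentiable (R : realType) (n m : nat)
    (S H : setmap R n m) (xbar : 'rV[R]_n) (ybar : 'rV[R]_m) : Prop :=
  forall d : R, 0 < d ->
  exists (U : set 'rV[R]_n) (V : set 'rV[R]_m),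
    [/\ nbhs xbar U, nbhs ybar V
      & forall x x', U x -> U x' ->
          S x `&` V `<=` msum (S x') (map_plus H d (x - x'))].

Definition tangent_cone (R : realType) (N : nat) (C : set 'rV[R]_N)
    (zbar : 'rV[R]_N) : set 'rV[R]_N :=
  [set w | exists (z : nat -> 'rV[R]_N) (tau : nat -> R),
    [/\ (forall i, C (z i)), z @ \oo --> zbar,
        (forall i, 0 < tau i), tau @ \oo --> (0 : R)
      & (fun i => (tau i)^-1 *: (z i - zbar)) @ \oo --> w]].

Definition graphical_derivative (R : realType) (n m : nat) (S : setmap R n m)
    (xbar : 'rV[R]_n) (ybar : 'rV[R]_m) : setmap R n m :=
  fun p => [set q | tangent_cone (gph S) (row_mx xbar ybar) (row_mx p q)].

(* Meant for C locally closed at zbar and zbar in C. *)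
Definition clarke_regular (R : realType) (N : nat) (C : set 'rV[R]_N)
    (zbar : 'rV[R]_N) : Prop :=
  forall rho e : R, 0 < rho -> 0 < e ->
  exists2 V : set 'rV[R]_N, nbhs zbar V &
    forall z, (C `&` V) z ->
      tangent_cone C zbar `&` cball 0 rho
        `<=` msum (tangent_cone C z) (cball 0 e).

(* Main.v *)
Require Import Defs.
From mathcomp Require Import all_boot all_order all_algebra.
From mathcomp Require Import all_classical all_reals all_analysis.
From mathcomp Require Import ring lra.
Import Order.TTheory GRing.Theory Num.Theory.
Import numFieldNormedType.Exports.
Local Open Scope classical_set_scope.
Local Open Scope ring_scope.

Set Implicit Arguments.
Unset Strict Implicit.
Unset Printing Implicit Defensive.

(** Necessity: applying the definition at [x = xbar], [x' = xbar + t p] with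
    [t] and [delta] tending to 0 gives difference quotients close to the compact
    set [- H (- p)]; a cluster point is the required element.

    Sufficiency: by Clarke regularity, at every point of the graph near
    [(xbar, ybar)] and for every [p] there are tangent directions close to
    [{p} x - H (- p)].  As [H (- p)] is convex and compact, following them
    reaches a point of the graph in [(x, y) + {p} x - H (- p)] up to an error
    [e |p|].  A minimisation argument then moves this point to the abscissa
    [x + p] exactly, at a cost proportional to the error.

    All estimates use the sup norm, which is equivalent to [enorm]. *)

(** * Sup norm and Euclidean norm on row vectors *)

Section Norms.
Variable R : realType.

Lemma normr_rV_le (N : nat) (x : 'rV[R]_N) (r : R) :
  `|x| <= r <-> 0 <= r /\ forall i, `|x 0 i| <= r.
Proof.
rewrite [`|x|]mx_normrE; split=> [/bigmax_leP[r0 xr]|[r0 xr]].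
  by split=> // i; exact: (xr (0, i)).
by apply/bigmax_leP; split=> // -[i j] _ /=; rewrite ord1.
Qed.

Lemma normr_coord_le (N : nat) (x : 'rV[R]_N) i : `|x 0 i| <= `|x|.
Proof. by have /normr_rV_le[_] := lexx `|x|; apply. Qed.

Lemma normr_row_mx_le (n m : nat) (x : 'rV[R]_n) (y : 'rV[R]_m) (r : R) :
  `|x| <= r -> `|y| <= r -> `|row_mx x y| <= r.
Proof.
move=> /normr_rV_le[r0 xr] /normr_rV_le[_ yr]; apply/normr_rV_le; split=> // i.
by rewrite mxE; case: fintype.split.
Qed.

Lemma normr_lsubmx_le (n m : nat) (z : 'rV[R]_(n + m)) : `|lsubmx z| <= `|z|.
Proof.
by apply/normr_rV_le; split=> // i; rewrite mxE; exact: normr_coord_le.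
Qed.

Lemma normr_rsubmx_le (n m : nat) (z : 'rV[R]_(n + m)) : `|rsubmx z| <= `|z|.
Proof.
by apply/normr_rV_le; split=> // i; rewrite mxE; exact: normr_coord_le.
Qed.

Lemma continuous_row_mx (n m : nat) :
  continuous (fun u : 'rV[R]_n * 'rV[R]_m => row_mx u.1 u.2).
Proof.
move=> -[x y]; apply/cvgrPdist_le => e e0.
near=> u; rewrite opp_row_mx add_row_mx /=; apply: normr_row_mx_le.
  by near: u; apply: (@cvgr_dist_le _ _ _ _ _ fst x) => //; exact: cvg_fst.
by near: u; apply: (@cvgr_dist_le _ _ _ _ _ snd y) => //; exact: cvg_snd.
Unshelve. all: by end_near.
Qed.

Lemma enorm_ge0 (N : nat) (x : 'rV[R]_N) : 0 <= enorm x.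
Proof. exact: sqrtr_ge0. Qed.

Lemma enormZ (N : nat) (k : R) (x : 'rV[R]_N) : enorm (k *: x) = `|k| * enorm x.
Proof.
rewrite /enorm -sqrtr_sqr -sqrtrM ?sqr_ge0 // mulr_sumr.
by congr Num.sqrt; apply: eq_bigr => i _; rewrite mxE exprMn.
Qed.

Lemma normr_le_enorm (N : nat) (x : 'rV[R]_N) : `|x| <= enorm x.
Proof.
apply/normr_rV_le; split=> [|i]; first exact: enorm_ge0.
rewrite -sqrtr_sqr; apply: ler_wsqrtr; rewrite (bigD1 i) //= lerDl.
by apply: sumr_ge0 => j _; exact: sqr_ge0.
Qed.

(** The constant is crude, [sqrt N] being the sharp one; taking the successor keeps it positive for
    [N = 0], so that radii can be divided by it. *)
Lemma enorm_le_normr (N : nat) (x : 'rV[R]_N) : enorm x <= N.+1%:R * `|x|.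
Proof.
have h : 0 <= N.+1%:R * `|x| by rewrite mulr_ge0.
rewrite -(ger0_norm h) -sqrtr_sqr; apply: ler_wsqrtr.
apply: (@le_trans _ _ (\sum_(i < N) `|x| ^+ 2)).
  apply: ler_sum => i _; rewrite -[x 0 i ^+ 2]real_normK ?num_real //.
  by rewrite lerXn2r ?nnegrE // normr_coord_le.
rewrite sumr_const card_ord -[leLHS]mulr_natl exprMn ler_wpM2r ?sqr_ge0 //.
rewrite -natrX ler_nat expnS expn1.
by apply: leq_trans (leqnSn N) _; rewrite leq_pmulr.
Qed.

End Norms.

(** * Working forms of convexity and of the tangent cone *)

Lemma convex_setP (R : realType) (E : lmodType R) (A : set E) :
  convex_set A <->
  forall (x y : E) (a b : R), A x -> A y -> 0 <= a -> 0 <= b -> a + b = 1 ->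
    A (a *: x + b *: y).
Proof.
split=> [cA x y a b Ax Ay a0 b0 ab|cA x y l].
  have a1 : a <= 1 by rewrite -ab lerDl.
  have -> : b = 1 - a by rewrite -ab addrC addKr.
  have := cA x y (Itv01 a0 a1); rewrite !inE => /(_ Ax Ay); exact.
rewrite !inE => Ax Ay; apply: cA => //; first by rewrite subr_ge0.
by rewrite addrC subrK.
Qed.

(** Trades sequences for one step length and one direction at each tolerance. Conversely, the
    tolerances [1 / (i + 1)] give the sequences, and the base points converge because the step
    lengths tend to 0 while the directions converge. *)
Lemma tangent_coneP (R : realType) (N : nat) (C : set 'rV[R]_N)
    (z w : 'rV[R]_N) :
  tangent_cone C z w <->
  forall e : R, 0 < e -> exists (t : R) (k : 'rV[R]_N),
    [/\ 0 < t, t <= e, C (z + t *: k) & `|k - w| <= e].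
Proof.
split=> [[u [tau [Cu _ tau0 taucvg ucvg]]] e e0|h].
  have /cvgr_dist_le/(_ _ e0) ft := taucvg.
  have /cvgr_dist_le/(_ _ e0) fu := ucvg.
  have [i [/= ti ui]] := filter_ex (filterI ft fu).
  exists (tau i), ((tau i)^-1 *: (u i - z)); split=> //.
  - by move: ti; rewrite sub0r normrN gtr0_norm.
  - by rewrite scalerA divff ?gt_eqF // scale1r addrC subrK.
  - by rewrite distrC.
have /choice[tk tkP] : forall i : nat, exists u : R * 'rV[R]_N,
    [/\ 0 < u.1, u.1 <= i.+1%:R^-1, C (z + u.1 *: u.2)
      & `|u.2 - w| <= i.+1%:R^-1].
  move=> i.
  have [|t [k tkP]] := h i.+1%:R^-1; first by rewrite invr_gt0.
  by exists (t, k).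
have t0 : (fun i => (tk i).1) @ \oo --> (0 : R).
  apply/cvgrPdist_le => e e0; near=> i; have [ti ti' _ _] := tkP i.
  rewrite sub0r normrN gtr0_norm //; apply: le_trans ti' _; apply: ltW.
  by near: i; exact: (near_infty_natSinv_lt (PosNum e0)).
have kw : (fun i => (tk i).2) @ \oo --> w.
  apply/cvgrPdist_le => e e0; near=> i; have [_ _ _ ki] := tkP i.
  rewrite distrC; apply: le_trans ki _; apply: ltW.
  by near: i; exact: (near_infty_natSinv_lt (PosNum e0)).
exists (fun i => z + (tk i).1 *: (tk i).2), (fun i => (tk i).1); split=> //.
- by move=> i; have [] := tkP i.
- rewrite -[X in _ --> X]addr0 -(scale0r w).
  by apply: cvgD; [exact: cvg_cst|exact: cvgZ].
- by move=> i; have [] := tkP i.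
- rewrite [X in X @ _ --> _](_ : _ = fun i => (tk i).2) //.
  apply/funext => i; have [ti _ _ _] := tkP i.
  by rewrite addrC addKr scalerA mulVf ?gt_eqF // scale1r.
Unshelve. all: by end_near.
Qed.

(** * Continuation along a compact convex set of directions *)

(* Take the largest t <= 1 such that z0 + t K meets C.  If t < 1, a small step
   from the point reached stays in z0 + (t + s) K because K is convex. *)
Lemma continuation (R : realType) (E : normedModType R) (C B K : set E)
    (z0 : E) :
  closed (C `&` B) -> compact K -> convex_set K -> C z0 -> B z0 ->
  (forall (t : R) k, 0 <= t -> t <= 1 -> K k -> B (z0 + t *: k)) ->
  (forall z, C z -> B z -> forall e : R, 0 < e ->
     exists (t : R) (k : E), [/\ 0 < t, t <= e, K k & C (z + t *: k)]) ->
  exists2 k, K k & C (z0 + k).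
Proof.
move=> clCB cK /convex_setP cvK Cz0 Bz0 KB step.
pose f (u : R * E) := z0 + u.1 *: u.2.
have cf : continuous f.
  by move=> u; apply: cvgD; [exact: cvg_cst|apply: cvgZ;
    [exact: cvg_fst|exact: cvg_snd]].
pose A := (`[0, 1]%classic `*` K) `&` f @^-1` (C `&` B).
have cA : compact A.
  apply: compact_closedI; first exact: compact_setX (@segment_compact _ 0 1) cK.
  exact: (continuous_closedP f).1 cf _ clCB.
(* Only a point of [K] is wanted here: at [t = 0] it shows that [A] is nonempty. *)
have [t0 [k0 [_ _ Kk0 _]]] := step _ Cz0 Bz0 1 ltr01.
have A0 : A !=set0.
  exists (0, k0); rewrite /A /f /= scale0r addr0; do 2!split=> //.
  by rewrite in_itv /= lexx ler01.
have [|[t k]] := compact_EVT_max A0 cA (f := fst).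
  by apply: continuous_subspaceT => u; exact: cvg_fst.
rewrite inE => -[[/= + Kk] [Ck Bk]] tmax; rewrite in_itv /= => /andP[t_ge0].
rewrite le_eqVlt => /orP[/eqP t1|t1].
  by exists k => //; move: Ck; rewrite /f /= t1 scale1r.
have [|s [l [s0 st Kl Cl]]] := step _ Ck Bk (1 - t); first by rewrite subr_gt0.
have ts0 : 0 < t + s by rewrite ltr_wpDl.
(* The weights give [(t + s) *: j = t *: k + s *: l], so the two consecutive steps become a single
   one from [z0], with a larger parameter than the maximal [t]. *)
pose j := (t / (t + s)) *: k + (s / (t + s)) *: l.
have Kj : K j.
  apply: cvK => //; [exact/divr_ge0/ltW|exact/divr_ge0/ltW/ts0/ltW|].
  by rewrite -mulrDl divff // gt_eqF.
have jE : z0 + (t + s) *: j = f (t, k) + s *: l.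
  rewrite /f /j /= scalerDr !scalerA !(mulrCA (t + s)) divff ?gt_eqF //.
  by rewrite !mulr1 addrA.
have ts1 : t + s <= 1 by rewrite -lerBrDl.
have /tmax /= : (t + s, j) \in A.
  rewrite inE; split; first by split=> //=; rewrite in_itv /= ts1 ltW.
  by split; [rewrite /f/= jE|apply: KB => //; exact: ltW].
by rewrite gerDl leNgt s0.
Qed.

(** * Sup-norm balls and tubes of directions *)

Lemma closed_norm_ball (R : realType) (E : normedModType R) (z : E) (r : R) :
  closed [set y | `|y - z| <= r].
Proof.
rewrite (_ : [set y | _] = closed_ball_ Num.norm z r).
  exact: closed_closed_ball_.
by apply/seteqP; split=> y /=; rewrite distrC.
Qed.

Lemma compact_norm_ball (R : realType) (N : nat) (z : 'rV[R]_N) (r : R) :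
  compact [set y | `|y - z| <= r].
Proof.
apply: bounded_closed_compact; last exact: closed_norm_ball.
exists (`|z| + r); split; first exact: num_real.
move=> s hs y /= yr; apply: le_trans (ltW hs).
by rewrite -(subrK z y) addrC (le_trans (ler_normD _ _)) // lerD2l.
Qed.

Lemma nbhs_norm_ballP (R : realType) (E : normedModType R) (z : E)
    (V : set E) :
  nbhs z V <-> exists2 d : R, 0 < d & [set y | `|y - z| <= d] `<=` V.
Proof.
split=> [/nbhs_closedballP[d dV]|[d d0 dV]].
  exists d%:num => // y /= yd; apply: dV.
  by rewrite closed_ballE //= /closed_ball_ /= distrC.
apply/nbhs_closedballP; exists (PosNum d0) => y.
by rewrite closed_ballE //= /closed_ball_ /= distrC => /dV.
Qed.

Section Tube.
Variables (R : realType) (n m : nat) (p : 'rV[R]_n) (A : set 'rV[R]_m) (e : R).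

(** The thickening is by a ball of the product space, so the abscissa [p] is blurred too. With
    [A = H (- p)] this is the set of directions fed to [continuation]. *)
Definition tube : set 'rV[R]_(n + m) :=
  [set row_mx p (- h) + b | h in A & b in [set b | `|b| <= e]].

Lemma compact_tube : compact A -> compact tube.
Proof.
move=> cA.
have -> : tube = (fun u : 'rV[R]_m * 'rV[R]_(n + m) => row_mx p (- u.1) + u.2)
    @` (A `*` [set b | `|b - 0| <= e]).
  apply/seteqP; split=> [_ [h Ah [b be <-]]|_ [[h b] [Ah be] <-]].
    by exists (h, b) => //; split=> //=; rewrite subr0.
  by exists h => //; exists b => //; move: be; rewrite /= subr0.
apply: continuous_compact; last first.
  exact: compact_setX cA (@compact_norm_ball _ _ 0 e).
apply: continuous_subspaceT => u; apply: cvgD; last exact: cvg_snd.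
apply: (cvg_comp2 (h := @row_mx R 1 n m) (cvg_cst p) (cvgN cvg_fst)).
exact: (@continuous_row_mx R n m (p, - u.1)).
Qed.

Lemma convex_tube : convex_set A -> convex_set tube.
Proof.
move=> /convex_setP cA; apply/convex_setP.
move=> _ _ a b [h Ah [k ke <-]] [h' Ah' [k' ke' <-]] a0 b0 ab.
exists (a *: h + b *: h'); first exact: cA.
exists (a *: k + b *: k').
  rewrite /= (le_trans (ler_normD _ _)) // !normrZ !ger0_norm //.
  rewrite -[leRHS]mul1r -ab mulrDl.
  by apply: lerD; rewrite ler_wpM2l.
rewrite !scalerDr addrACA !scale_row_mx add_row_mx -scalerDl ab scale1r.
by rewrite !scalerN opprD.
Qed.

End Tube.

(** * Sup-norm consequences of local closedness and of the prefan bound *)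

Lemma locally_closed_norm_ball (R : realType) (n m : nat) (S : setmap R n m)
    (x : 'rV[R]_n) (y : 'rV[R]_m) :
  locally_closed_at S x y ->
  exists2 e : R, 0 < e &
    forall s, s <= e -> closed (gph S `&` [set z | `|z - row_mx x y| <= s]).
Proof.
case=> e e0 cl; exists (e / (n + m).+1%:R) => [|s se]; first exact: divr_gt0.
rewrite (_ : _ `&` _ = (gph S `&` cball (row_mx x y) e) `&`
  [set z | `|z - row_mx x y| <= s]).
  by apply: closedI => //; exact: closed_norm_ball.
apply/seteqP; split=> z; last by case=> -[].
case=> Sz zs; split=> //; split=> //.
rewrite /cball /= (le_trans (enorm_le_normr _)) // mulrC -ler_pdivlMr //.
exact: le_trans zs se.
Qed.

(** By homogeneity, [w] can be rescaled to the Euclidean unit sphere, where [outer_norm H] bounds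
    the values; the factor [n.+1] pays for the return to the sup norm. *)
Lemma prefan_bound (R : realType) (n m : nat) (H : setmap R n m) :
  prefan H ->
  exists2 M : R, 0 <= M & forall w h, w != 0 -> H w h -> `|h| <= M * `|w|.
Proof.
case=> -[_ hom] _ fin; pose M := `|fine (outer_norm H)|.
have M0 : 0 <= M by exact: normr_ge0.
exists (M * n.+1%:R) => [|w h w0 Hwh]; first exact: mulr_ge0.
have c0 : 0 < enorm w.
  by apply: lt_le_trans (normr_le_enorm w); rewrite normr_gt0.
have h1 : enorm ((enorm w)^-1 *: h) <= M.
  apply: (le_trans _ (ler_norm _)); rewrite -lee_fin fineK //.
  apply: (@le_trans _ _ (ereal_sup [set (enorm z)%:E
      | z in H ((enorm w)^-1 *: w)])).
    apply: ereal_sup_ubound; exists ((enorm w)^-1 *: h) => //.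
    by rewrite hom ?invr_gt0 //; exists h.
  apply: ereal_sup_ubound; exists ((enorm w)^-1 *: w) => //=.
  by rewrite enormZ ger0_norm ?invr_ge0 ?enorm_ge0 // mulVf ?gt_eqF.
apply: le_trans (normr_le_enorm h) _; rewrite -mulrA.
apply: (@le_trans _ _ (M * enorm w)).
  move: h1; rewrite enormZ ger0_norm ?invr_ge0 ?enorm_ge0 //.
  by rewrite mulrC ler_pdivrMr.
by rewrite ler_wpM2l //; exact: enorm_le_normr.
Qed.

(** * From approximate steps to an exact abscissa *)

(* Ekeland-style descent: a minimiser of 4 L |x_w - x'| + |w - z| over the
   points w of C near zbar must satisfy x_w = x'. *)
Lemma exact_solution_of_approximate_steps (R : realType) (n m : nat)
    (C : set 'rV[R]_(n + m)) (zbar : 'rV[R]_(n + m)) (r L : R) :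
  1 <= L -> closed (C `&` [set z | `|z - zbar| <= r]) ->
  (forall z (p : 'rV[R]_n), C z -> `|z - zbar| <= r -> `|p| <= r ->
     exists z1, [/\ C z1, `|lsubmx z1 - lsubmx z - p| <= `|p| / 2
                  & `|z1 - z| <= L * `|p|]) ->
  forall z x', C z -> `|z - zbar| <= r / (12 * L) ->
    `|x' - lsubmx zbar| <= r / (12 * L) ->
    exists z', [/\ C z', lsubmx z' = x'
                 & `|z' - z| <= 4 * L * `|x' - lsubmx z|].
Proof.
move=> L1 cl step z x' Cz zr x'r.
have L0 : 0 < L by lra.
have r0 : 0 <= r.
  have : 0 <= r / (12 * L) by apply: le_trans zr.
  by rewrite pmulr_lge0 // invr_gt0; lra.
(* The factor 12 keeps every point below inside the ball of radius [r]: [|w - z|] is at most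
   [8 L s = 2 r / 3], and [z] is within [r / 12] of [zbar]. *)
set s := r / (12 * L) in zr x'r.
have sL : L * s = r / 12.
  by rewrite /s; field; rewrite gt_eqF.
have s0 : 0 <= s by apply: le_trans zr.
have sr : s <= r / 12 by rewrite -sL ler_peMl.
pose f (w : 'rV[R]_(n + m)) := 4 * L * `|lsubmx w - x'| + `|w - z|.
have cf : continuous f.
  move=> w.
  have c1 : `|lsubmx v - x'| @[v --> w] --> `|lsubmx w - x'|.
    exact: cvg_norm (cvgB (@continuous_lsubmx R 1 n m w) (cvg_cst x')).
  have c2 : `|v - z| @[v --> w] --> `|w - z|.
    exact: cvg_norm (cvgB cvg_id (cvg_cst z)).
  exact: cvgD (cvgM (cvg_cst (4 * L)) c1) c2.
pose D := C `&` [set w | `|w - zbar| <= r].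
have cD : compact D.
  by apply: (subclosed_compact cl (@compact_norm_ball _ _ zbar r)) => w [].
have Dz : D z by split=> //=; lra.
have [|w] := EVT_min_rV (f := f) (ex_intro _ z Dz) cD.
  exact: continuous_subspaceT.
rewrite inE => -[Cw wr] wmin.
have xz : `|x' - lsubmx z| <= 2 * s.
  have h : `|lsubmx zbar - lsubmx z| <= s.
    by rewrite -linearB (le_trans (normr_lsubmx_le _)) // distrC.
  by have := ler_distD (lsubmx zbar) x' (lsubmx z); lra.
(* Comparison of the minimiser with [z]; once the abscissa of [w] is [x'], this is the required
   estimate. *)
have fw : f w <= 4 * L * `|x' - lsubmx z|.
  have := wmin z; rewrite inE => /(_ Dz).
  by rewrite {2}/f subrr normr0 addr0 (distrC (lsubmx z)).
have LW : 0 <= L * `|lsubmx w - x'| by rewrite mulr_ge0 // ltW.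
have Lxz : L * `|x' - lsubmx z| <= r / 6.
  have : L * `|x' - lsubmx z| <= L * (2 * s) by rewrite ler_pM2l.
  by rewrite mulrCA sL; lra.
have fwE : 4 * (L * `|lsubmx w - x'|) + `|w - z| <= 4 * (L * `|x' - lsubmx z|).
  by move: fw; rewrite /f -!mulrA.
have Lp : `|lsubmx w - x'| <= L * `|lsubmx w - x'| by rewrite ler_peMl.
have wz0 : 0 <= `|w - z| by [].
have [x'E|px] := eqVneq (lsubmx w) x'.
  by exists w; split=> //; rewrite -mulrA; lra.
have pr : `|x' - lsubmx w| <= r by rewrite distrC; lra.
have [w1 [Cw1 w1p w1w]] := step w (x' - lsubmx w) Cw wr pr.
have w1x' : `|lsubmx w1 - x'| <= `|lsubmx w - x'| / 2.
  move: w1p; rewrite (distrC x') (_ : _ - _ - _ = lsubmx w1 - x') //.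
  by rewrite opprB addrA subrK.
have w1z := ler_distD w w1 z.
rewrite (distrC x') in w1w.
have Dw1 : D w1.
  split=> //=; have := ler_distD w w1 zbar; have := ler_distD z w zbar; lra.
(* Put [a = L |x_w - x'|]. Moving from [w] to [w1] lowers the first term of [f] by at least [2 a]
   and raises the second by at most [a], which contradicts minimality since [a > 0]. *)
have := wmin w1; rewrite inE => /(_ Dw1); rewrite /f -!mulrA => fw1.
have Lw1 : L * `|lsubmx w1 - x'| <= L * `|lsubmx w - x'| / 2.
  by rewrite -mulrA ler_pM2l.
have Lpos : 0 < L * `|lsubmx w - x'| by rewrite mulr_gt0 // normr_gt0 subr_eq0.
lra.
Qed.

(** * Steps along the graph with a small relative error *)

(** Clarke regularity carries the tangent directions at the reference point to all nearby graph
    points with a uniform error, and [continuation] in the tube over [H (- p)] turns these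
    infinitesimal steps into a full one. The radius [r] serves all [z] and [p]. *)
Lemma approximate_step (R : realType) (n m : nat) (S H : setmap R n m)
    (xbar : 'rV[R]_n) (ybar : 'rV[R]_m) (e : R) :
  locally_closed_at S xbar ybar -> clarke_regular (gph S) (row_mx xbar ybar) ->
  prefan H ->
  (forall p : 'rV[R]_n, p <> 0 ->
    (graphical_derivative S xbar ybar p `&` [set - z | z in H (- p)]) !=set0) ->
  0 < e ->
  exists2 r : R, 0 < r & forall z (p : 'rV[R]_n),
    gph S z -> `|z - row_mx xbar ybar| <= r -> `|p| <= r ->
    exists h b, [/\ H (- p) h, `|b| <= e * `|p|
                  & gph S (z + (row_mx p (- h) + b))].
Proof.
move=> hS hreg hH hD e0.
have [M M0 HM] := prefan_bound hH.
have [[H0 hom] Hval _] := hH.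
have [c c0 cl] := locally_closed_norm_ball hS.
set zbar := row_mx xbar ybar in cl hreg *.
(* This radius bounds the Euclidean norm of [row_mx p1 q1] when [|p1| = 1] and [|q1| <= M]. *)
have rho0 : 0 < (n + m).+1%:R * (1 + M) by rewrite mulr_gt0 // ltr_pwDl.
have e20 : 0 < e / 2 by rewrite divr_gt0.
have [V /nbhs_norm_ballP[d d0 dV] regV] := hreg _ _ rho0 e20.
pose s := Num.min d c.
have s0 : 0 < s by rewrite lt_min d0.
have k0 : 0 < 2 + M + e by lra.
(* Tube elements have norm at most [(1 + M + e) |p|], so [r + (1 + M + e) r = s] keeps the whole
   path where both regularity and closedness apply. *)
exists (s / (2 + M + e)) => [|z p Sz zr pr]; first exact: divr_gt0.
have rs : s / (2 + M + e) * (2 + M + e) = s by rewrite divfK // gt_eqF.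
set r := s / (2 + M + e) in rs zr pr.
have r0 : 0 < r by rewrite divr_gt0.
have [->|p0] := eqVneq p 0.
  exists 0, 0; split; rewrite ?oppr0 ?normr0 ?mulr0 //.
  by rewrite row_mx0 !addr0.
have lam0 : 0 < `|p| by rewrite normr_gt0.
have Np0 : - p != 0 by rewrite oppr_eq0.
pose B := [set w | `|w - zbar| <= s].
have rle : r <= s by rewrite -rs ler_peMr ?ltW //; lra.
have tube_bound k : tube p (H (- p)) (e * `|p|) k -> `|k| <= (1 + M + e) * `|p|.
  case=> h Hh [b be <-]; apply: le_trans (ler_normD _ _) _.
  rewrite [leRHS]mulrDl; apply: lerD => //; apply: normr_row_mx_le.
    by rewrite ler_peMl //; lra.
  have := HM _ _ Np0 Hh; rewrite !normrN => /le_trans; apply.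
  by rewrite ler_wpM2r //; lra.
have tube_scale t k : 0 <= t -> t <= 1 -> tube p (H (- p)) (e * `|p|) k ->
    B (z + t *: k).
  move=> t0 t1 /tube_bound kb; rewrite /B /= addrAC.
  apply: le_trans (ler_normD _ _) _; rewrite normrZ ger0_norm //.
  have tk : t * `|k| <= `|k| by rewrite ler_piMl.
  have kr : (1 + M + e) * `|p| <= (1 + M + e) * r.
    by rewrite ler_wpM2l //; lra.
  by move: rs; rewrite mulrDr mulrDr mulrDl in kr *; nra.
have [Hp0 Hpconv Hpcomp] := Hval (- p).
have [|||||||k [h Hh [b be <-]] Sk] := @continuation R _ (gph S) B
    (tube p (H (- p)) (e * `|p|)) z.
- by apply: cl; rewrite ge_min lexx orbT.
- exact: compact_tube.
- exact: convex_tube.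
- exact: Sz.
- exact: le_trans zr rle.
- exact: tube_scale.
- move=> w Sw Bw u u0.
  (* Regularity is uniform only on bounded sets of directions, so it is used at the normalised [p1];
     homogeneity of [H] scales the result back. *)
  pose p1 := `|p|^-1 *: p.
  have pE : p = `|p| *: p1 by rewrite scalerA divff ?gt_eqF // scale1r.
  have p1n : `|p1| = 1 by rewrite normrZ ger0_norm ?invr_ge0 // mulVf ?gt_eqF.
  have p10 : p1 != 0 by rewrite -normr_eq0 p1n oner_eq0.
  have [q1 [Dq1 [h1 Hh1 q1E]]] := hD p1 (elimN eqP p10).
  have Wrho : cball 0 ((n + m).+1%:R * (1 + M)) (row_mx p1 q1).
    rewrite /cball /= subr0 (le_trans (enorm_le_normr _)) // ler_wpM2l //.
    apply: normr_row_mx_le; first by rewrite p1n lerDl.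
    rewrite -q1E normrN; have := HM (- p1) h1; rewrite oppr_eq0 normrN p1n.
    by move=> /(_ p10 Hh1); lra.
  have Vw : V w by apply: dV; apply: le_trans Bw _; rewrite ge_min lexx.
  have [a Ta [b' + ab']] := regV w (conj Sw Vw) _ (conj Dq1 Wrho).
  rewrite /cball /= subr0 => b'e.
  have /tangent_coneP Ta' := Ta.
  (* One half of [e] is lost here and the other in regularity. The bound [u * |p|] makes the
     rescaled step length [t / |p|] at most [u]. *)
  have [|t [k [t0 tu Sk ka]]] := Ta' (Num.min (e / 2) (u * `|p|)).
    by rewrite lt_min e20 mulr_gt0.
  exists (t / `|p|), (`|p| *: k); split.
  + exact: divr_gt0.
  + by rewrite ler_pdivrMr //; apply: le_trans tu _; rewrite ge_min lexx orbT.
  + exists (`|p| *: h1).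
      by rewrite [in H _]pE -scalerN hom //; exists h1.
    exists (`|p| *: (k - row_mx p1 q1)).
      rewrite /= normrZ normr_id mulrC ler_pM2r //.
      rewrite -ab' opprD addrA (le_trans (ler_normB _ _)) //.
      have h2 : `|k - a| <= e / 2.
        by apply: le_trans ka _; rewrite ge_min lexx.
      by have := normr_le_enorm b'; lra.
    rewrite -scalerN q1E {1}pE -scale_row_mx -scalerDr; congr (_ *: _).
    by rewrite addrC subrK.
  + by rewrite scalerA divfK ?gt_eqF.
by exists h, b.
Qed.

(** * Necessity of the derivative condition *)

Lemma graphical_derivative_meets_prefan (R : realType) (n m : nat)
    (S H : setmap R n m) (xbar : 'rV[R]_n) (ybar : 'rV[R]_m) :
  gph S (row_mx xbar ybar) -> prefan H ->
  pseudo_strictly_differentiable S H xbar ybar ->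
  forall p : 'rV[R]_n, p <> 0 ->
    (graphical_derivative S xbar ybar p `&` [set - z | z in H (- p)]) !=set0.
Proof.
move=> hxy [[H0 hom] Hval _] hdiff p /eqP p0.
have Sxy : S xbar ybar by move: hxy; rewrite /gph /= row_mxKl row_mxKr.
have approx (e : R) : 0 < e -> exists (t : R) (h b : 'rV[R]_m),
    [/\ 0 < t, t <= e, H (- p) h, `|b| <= e
      & S (xbar + t *: p) (ybar + t *: (- h + b))].
  move=> e0; have ep0 : 0 < enorm p.
    by apply: lt_le_trans (normr_le_enorm p); rewrite normr_gt0.
  (* With this choice the error radius at [x - x' = - t p] is exactly [t * e], that is, [e] after
     division by [t]. *)
  have [|U [V [/nbhs_norm_ballP[r r0 rU] nV UV]]] := hdiff (e / enorm p).
    exact: divr_gt0.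
  have np0 : 0 < `|p| by rewrite normr_gt0.
  pose t := Num.min e (r / `|p|).
  have t0 : 0 < t by rewrite lt_min e0 divr_gt0.
  have Ux : U xbar by apply: rU; rewrite /= subrr normr0 ltW.
  have Utp : U (xbar + t *: p).
    apply: rU; rewrite /= addrC addKr normrZ ger0_norm ?(ltW t0) //.
    by rewrite -ler_pdivlMr // ge_min lexx orbT.
  have := UV _ _ Ux Utp ybar (conj Sxy (nbhs_singleton nV)).
  rewrite opprD addrA subrr add0r -scalerN.
  move=> [y Sy [v [g]]]; rewrite hom // => -[h Hh hE] [_ [b b1 <-] vE] yE.
  exists t, h, (- (e *: b)); split=> //.
  - by rewrite ge_min lexx.
  - rewrite normrN normrZ ger0_norm ?(ltW e0) // ler_piMr ?(ltW e0) //.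
    by apply: le_trans (normr_le_enorm b) _; move: b1; rewrite /cball /= subr0.
  - rewrite (_ : ybar + _ = y) //.
    rewrite -yE -vE -hE enormZ ger0_norm ?(ltW t0) //.
    rewrite -scaleN1r enormZ normrN normr1 mul1r mulrCA divfK ?gt_eqF //.
    by rewrite -scalerA -addrA -scalerDr -scalerDr -opprD subrr scaler0 addr0.
have /choice[h hP] : forall i : nat, exists h : 'rV[R]_m, H (- p) h /\
    exists (t : R) (b : 'rV[R]_m), [/\ 0 < t, t <= i.+1%:R^-1,
      `|b| <= i.+1%:R^-1 & S (xbar + t *: p) (ybar + t *: (- h + b))].
  move=> i; have [|t [h [b [t0 ti Hh bi St]]]] := approx i.+1%:R^-1.
    by rewrite invr_gt0.
  by exists h; split=> //; exists t, b.
have [_ _ /(_ (h @ \oo) _)] := Hval (- p).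
case=> [|hb [Hhb clhb]]; first by exists 0%N => // i _; case: (hP i).
exists (- hb); split; last by exists hb.
apply/tangent_coneP => e e0.
have e20 : 0 < e / 2 by rewrite divr_gt0.
have nb : nbhs hb [set y | `|y - hb| <= e / 2].
  by apply/nbhs_norm_ballP; exists (e / 2).
(* Clustering is tested against a tail of the sequence, which yields one index that is both large
   and has [h i] close to [hb]. *)
have fi : (h @ \oo) [set h i | i in [set i | i.+1%:R^-1 < e / 2]].
  have [N _ Ne] := near_infty_natSinv_lt (PosNum e20).
  by exists N => // i /Ne ie; exists i.
have [_ [[i /= ie <-] hi]] := clhb _ _ fi nb.
have [_ [t [b [t0 ti bi St]]]] := hP i.
have te : t <= e / 2 := ltW (le_lt_trans ti ie).
have be : `|b| <= e / 2 := ltW (le_lt_trans bi ie).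
exists t, (row_mx p (- h i + b)); split=> //; first by lra.
  by rewrite /gph /= scale_row_mx add_row_mx row_mxKl row_mxKr.
rewrite opp_row_mx add_row_mx subrr; apply: normr_row_mx_le.
  by rewrite normr0 ltW.
rewrite opprK addrAC (le_trans (ler_normD _ _)) //.
by move: hi; rewrite /= -opprB normrN [_ - h i]addrC; lra.
Qed.

(** * Sufficiency of the derivative condition *)

(** Approximate steps are used twice: with error [1 / 2] they allow any abscissa to be reached
    exactly at a linear cost [4 L]; with a small error [e] they give a point almost above [x'],
    which the first result then moves above [x']. *)
Lemma pseudo_strictly_differentiable_of_derivative (R : realType) (n m : nat)
    (S H : setmap R n m) (xbar : 'rV[R]_n) (ybar : 'rV[R]_m) :
  locally_closed_at S xbar ybar -> clarke_regular (gph S) (row_mx xbar ybar) ->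
  prefan H ->
  (forall p : 'rV[R]_n, p <> 0 ->
    (graphical_derivative S xbar ybar p `&` [set - z | z in H (- p)]) !=set0) ->
  pseudo_strictly_differentiable S H xbar ybar.
Proof.
move=> hS hreg hH hD d d0.
have [M M0 HM] := prefan_bound hH.
have [c c0 cl] := locally_closed_norm_ball hS.
set zbar := row_mx xbar ybar in cl.
have half0 : (0 : R) < 1 / 2 by lra.
have [r1 r10 step1] := approximate_step hS hreg hH hD half0.
(* A coarse step has length at most [(1 + M) |p| + |p| / 2]. *)
pose L := 2 + M; pose r := Num.min c r1.
have L1 : 1 <= L by rewrite /L; lra.
have r0 : 0 < r by rewrite lt_min c0.
have exact_sol : forall z x', gph S z -> `|z - zbar| <= r / (12 * L) ->
    `|x' - xbar| <= r / (12 * L) ->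
    exists z', [/\ gph S z', lsubmx z' = x'
                 & `|z' - z| <= 4 * L * `|x' - lsubmx z|].
  have := @exact_solution_of_approximate_steps R n m (gph S) zbar r L L1.
  rewrite row_mxKl; apply; first by apply: cl; rewrite ge_min lexx.
  move=> z p Sz zr pr.
  have r1r : r <= r1 by rewrite ge_min lexx orbT.
  have [h [b [Hh be Sk]]] := step1 z p Sz (le_trans zr r1r) (le_trans pr r1r).
  have [p0|p0] := eqVneq p 0.
    by exists z; rewrite p0 !subrr !normr0 mulr0 mul0r.
  exists (z + (row_mx p (- h) + b)); split=> //.
    rewrite !linearD /= row_mxKl [lsubmx z + _]addrC addrK [p + _]addrC addrK.
    by apply: le_trans (normr_lsubmx_le _) _; lra.
  rewrite addrC addKr (le_trans (ler_normD _ _)) //.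
  have : `|row_mx p (- h)| <= (1 + M) * `|p|.
    apply: normr_row_mx_le; first by rewrite ler_peMl //; lra.
    have Np0 : - p != 0 by rewrite oppr_eq0.
    have := HM _ _ Np0 Hh; rewrite !normrN => /le_trans; apply.
    by rewrite ler_wpM2r //; lra.
  by have := normr_ge0 p; rewrite /L; nra.
have s0 : 0 < r / (12 * L) by rewrite divr_gt0 //; lra.
set s := r / (12 * L) in s0 exact_sol.
(* The final error is at most [(1 + 4 L) e |p|] in the sup norm; [m.+1] converts it to the Euclidean
   norm, and the product is [d |p|]. *)
pose e := d / (m.+1%:R * (1 + 4 * L)).
have q0 : 0 < m.+1%:R * (1 + 4 * L) by rewrite mulr_gt0 //; lra.
have e0 : 0 < e by rewrite divr_gt0.
have [r2 r20 step2] := approximate_step hS hreg hH hD e0.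
(* The fine step from within [t] of [zbar] with [|p| <= t] ends within [(2 + M + e) t], hence within
   [s], where the exact correction is available. *)
pose t := Num.min r2 (s / (3 + 2 * M + 2 * e)).
have k0 : 0 < 3 + 2 * M + 2 * e by lra.
have t0 : 0 < t by rewrite lt_min r20 divr_gt0.
have tr2 : t <= r2 by rewrite ge_min lexx.
have ts : t * (3 + 2 * M + 2 * e) <= s.
  by rewrite -ler_pdivlMr // ge_min lexx orbT.
exists [set x | `|x - xbar| <= t / 2], [set y | `|y - ybar| <= t].
have t20 : 0 < t / 2 by lra.
split; [by apply/nbhs_norm_ballP; exists (t / 2)
       |by apply/nbhs_norm_ballP; exists t|].
move=> x x' /= xt x't y [Sxy /= yt].
pose p := x' - x.
have pt : `|p| <= t.
  by have := ler_distD xbar x' x; rewrite (distrC xbar); lra.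
have zt : `|row_mx x y - zbar| <= t.
  by rewrite opp_row_mx add_row_mx; apply: normr_row_mx_le => //; lra.
have Sz : gph S (row_mx x y) by rewrite /gph /= row_mxKl row_mxKr.
have [h [b [Hh be Sz2]]] := step2 _ p Sz (le_trans zt tr2) (le_trans pt tr2).
set z2 := row_mx x y + _ in Sz2.
have lz2 : lsubmx z2 = x' + lsubmx b.
  by rewrite /z2 !linearD /= !row_mxKl addrA [x + _]addrC subrK.
have rz2 : rsubmx z2 = y - h + rsubmx b.
  by rewrite /z2 !linearD /= !row_mxKr addrA.
have [pE|p0] := eqVneq p 0.
  have x'E : x' = x by apply/eqP; rewrite -subr_eq0 -/p pE.
  exists y; first by rewrite x'E.
  exists 0; last by rewrite addr0.
  rewrite x'E subrr; exists 0; first by case: hH => -[].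
  exists 0; last by rewrite addr0.
  exists 0; last by rewrite scaler0.
  by rewrite /cball /= subr0 (le_trans (enorm_le_normr _)) // normr0 mulr0.
have hM : `|h| <= M * `|p|.
  by have := HM (- p) h; rewrite oppr_eq0 normrN; apply.
have np := normr_ge0 p.
have z2s : `|z2 - zbar| <= s.
  rewrite /z2 addrAC (le_trans (ler_normD _ _)) //.
  have h1 : `|row_mx p (- h)| <= (1 + M) * `|p|.
    apply: normr_row_mx_le; first by rewrite ler_peMl //; lra.
    by rewrite normrN; lra.
  by have := ler_normD (row_mx p (- h)) b; nra.
have x's : `|x' - xbar| <= s by nra.
(* The abscissa of [z2] misses [x'] only by [lsubmx b], so the correction costs at most
   [4 L e |p|]. *)
have [z' [Sz' lz' z'z]] := exact_sol z2 x' Sz2 z2s x's.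
rewrite lz2 (opprD x') addrA subrr add0r normrN in z'z.
have lb : `|lsubmx b| <= e * `|p| := le_trans (normr_lsubmx_le _) be.
have rb : `|rsubmx b| <= e * `|p| := le_trans (normr_rsubmx_le _) be.
exists (rsubmx z'); first by rewrite -lz'; exact: Sz'.
(* The error left in [y = y' + h + beta], where [y'] is the ordinate of [z']: it collects the
   correction from [z2] to [z'] and the ordinate of [b]. *)
pose beta := y - rsubmx z' - h.
have betaE : beta = - (rsubmx (z' - z2) + rsubmx b).
  rewrite linearB /= rz2 /beta; apply/rowP => i; rewrite !mxE; ring.
have betan : enorm beta <= d * enorm p.
  apply: le_trans (enorm_le_normr _) _.
  have h1 : `|beta| <= (1 + 4 * L) * (e * `|p|).
    rewrite betaE normrN (le_trans (ler_normD _ _)) //.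
    have h2 := le_trans (normr_rsubmx_le (z' - z2)) z'z.
    have : L * `|lsubmx b| <= L * (e * `|p|) by rewrite ler_wpM2l //; lra.
    by move: h2; rewrite -mulrA; lra.
  apply: (@le_trans _ _ (d * `|p|)); last first.
    by rewrite ler_pM2l // normr_le_enorm.
  apply: (@le_trans _ _ (m.+1%:R * ((1 + 4 * L) * (e * `|p|)))).
    by rewrite ler_wpM2l.
  have <- : e * (m.+1%:R * (1 + 4 * L)) = d by rewrite divfK // gt_eqF.
  by rewrite le_eqVlt; apply/orP; left; apply/eqP; ring.
have ep0 : 0 < enorm p.
  by apply: lt_le_trans (normr_le_enorm p); rewrite normr_gt0.
have epE : enorm (x - x') = enorm p.
  by rewrite -opprB -scaleN1r enormZ normrN normr1 mul1r.
exists (h + beta); last by rewrite /beta; apply/rowP => i; rewrite !mxE; ring.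
exists h; first by move: Hh; rewrite opprB.
exists beta => //; exists ((d * enorm p)^-1 *: beta); last first.
  by rewrite epE scalerA divff ?scale1r // gt_eqF // mulr_gt0.
have dp0 : 0 < d * enorm p by rewrite mulr_gt0.
rewrite /cball /= subr0 enormZ gtr0_norm ?invr_gt0 //.
by rewrite mulrC ler_pdivrMr ?mul1r.
Qed.

Theorem corollary3p6 (R : realType) (n m : nat) (S H : setmap R n m)
    (xbar : 'rV[R]_n) (ybar : 'rV[R]_m)
    (hxy : gph S (row_mx xbar ybar))
    (hS : locally_closed_at S xbar ybar)
    (hreg : clarke_regular (gph S) (row_mx xbar ybar))
    (hH : prefan H) :
  pseudo_strictly_differentiable S H xbar ybar <->
  (forall p : 'rV[R]_n, p <> 0 ->
     (graphical_derivative S xbar ybar p `&` [set - z | z in H (- p)]) !=set0).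
Proof.
split; first exact: graphical_derivative_meets_prefan.
exact: pseudo_strictly_differentiable_of_derivative.
Qed.
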